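(* There are isomorphisms $$MS\cong\mathcal{MS}_{n,d},\qquad MH\cong\mathcal{MH},\qquad MV\cong\mathcal{MV},$$ the first two as $\mathcal{A}$-algebras and the third as $\mathcal{A}$-modules.
   Context: Let $v$ be an indeterminate, $\mathcal{A}=\mathbb{Z}[v,v^{-1}]$, $n,d$ positive integers, $\mathbb{F}_q$ the finite field with $q$ elements, $V=\mathbb{F}_q^d$, $G=GL_d(\mathbb{F}_q)$. Let $\mathscr{X}$ be the set of flags $(0=V_0\subseteq V_1\subseteq\cdots\subseteq V_n=V)$ (inclusions not necessarily strict) and $\mathscr{Y}$ the set of complete flags in $V$. For a finite set $S$ with an action of a group $\Gamma$, $\mathcal{A}_\Gamma(S)$ denotes the $\mathcal{A}$-module of $\Gamma$-invariant $\mathcal{A}$-valued functions on $S$. $\mathcal{MS}_{n,d}=\mathcal{A}_G(\mathscr{X}\times\mathscr{X}\times V)$, $\mathcal{MH}=\mathcal{A}_G(\mathscr{Y}\times\mathscr{Y}\times V)$, $\mathcal{MV}=\mathcal{A}_G(\mathscr{X}\times\mathscr{Y}\times V)$ ($G$ acting diagonally); the first two are algebras under the convolution $(g*h)(f,f',\omega)=\sum_{f'',\,\mu\in V}g(f,f'',\mu)h(f'',f',\omega-\mu)$, with $f''$ running over $\mathscr{X}$, respectively $\mathscr{Y}$. Let $G'=V\rtimes G$ act on $X=\mathscr{X}\times V$ and $Y=\mathscr{Y}\times V$ by $(\omega,g)\cdot(f,\omega_1)=(g\cdot f,\,g\cdot\omega_1+\omega)$, and diagonally on $X\times X$, $Y\times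 Y$, $X\times Y$. Put $MS=\mathcal{A}_{G'}(X\times X)$, $MH=\mathcal{A}_{G'}(Y\times Y)$, $MV=\mathcal{A}_{G'}(X\times Y)$; $MS$ and $MH$ are algebras under the convolution $(h_1*h_2)(f,\omega,f',\omega')=\sum_{f'',\omega''}h_1(f,\omega,f'',\omega'')h_2(f'',\omega'',f',\omega')$, with $(f'',\omega'')$ running over $X$, respectively $Y$. *)

(* Defs.v *)
From HB Require Import structures.
From mathcomp Require Import all_boot all_order all_fingroup all_algebra.
From mathcomp Require Import boolp.
Set Implicit Arguments.
Unset Strict Implicit.
Unset Printing Implicit Defensive.
Import GRing.Theory.
Local Open Scope ring_scope.

(* Z[v, v^-1], as the subring of the fraction field Q(v) of Z[v] consisting   *)
(* of the p / v^k.                                                            *)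
Definition laurent_pred : {pred {fraction {poly int}}} :=
  fun x => `[< exists (p : {poly int}) (k : nat),
    x = tofrac p / tofrac 'X ^+ k >].

Lemma fracX_neq0 (k : nat) : tofrac ('X : {poly int}) ^+ k != 0.
Proof. by rewrite expf_neq0 // tofrac_eq0 polyX_eq0. Qed.

Lemma laurent_subring_closed : subring_closed laurent_pred.
Proof.
split.
- by apply/asboolP; exists 1, 0%N; rewrite expr0 divr1 tofrac1.
- move=> _ _ /asboolP[p [k ->]] /asboolP[r [l ->]]; apply/asboolP.
  exists (p * 'X^l - r * 'X^k), (k + l)%N.
  rewrite -mulNr addf_div ?fracX_neq0 // tofracB !tofracM !tofracXn exprD.
  by rewrite mulNr.
- move=> _ _ /asboolP[p [k ->]] /asboolP[r [l ->]]; apply/asboolP.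
  by exists (p * r), (k + l)%N; rewrite mulf_div exprD tofracM.
Qed.

HB.instance Definition _ :=
  GRing.isSubringClosed.Build _ laurent_pred laurent_subring_closed.

Record laurent := Laurent {
  laurent_val :> {fraction {poly int}};
  _ : laurent_val \in laurent_pred }.

HB.instance Definition _ := [isSub for laurent_val].
HB.instance Definition _ := [Choice of laurent by <:].
HB.instance Definition _ := [SubChoice_isSubComNzRing of laurent by <:].

(* Left actions; the library's {action gT &-> T} are right actions.           *)
Record lact (gT : groupType) (S : Type) := Lact {
  lact_fun :> gT -> S -> S;
  lact1 : forall x, lact_fun 1%g x = x;
  lactM : forall a b x, lact_fun (a * b)%g x = lact_fun a (lact_fun b x) }.

(* Left actions by additive automorphisms.                                     *)
Record alact (gT : groupType) (U : zmodType) := ALact {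
  alact_lact :> lact gT U;
  alactB : forall a u w,
    alact_lact a (u - w) = alact_lact a u - alact_lact a w }.

Section LeftActions.
Variable gT : groupType.

Lemma lactK (S : Type) (to : lact gT S) (a : gT) : cancel (to a) (to a^-1%g).
Proof. by move=> x; rewrite -lactM mulVg lact1. Qed.

Lemma lact_bij (S : Type) (to : lact gT S) (a : gT) : bijective (to a).
Proof.
exists (to a^-1%g); first exact: lactK.
by move=> x; rewrite -{1}(invgK a) lactK.
Qed.

Definition prod_act (S T : Type) (sto : lact gT S) (tto : lact gT T)
    (a : gT) (u : S * T) : S * T := (sto a u.1, tto a u.2).

Lemma prod_act1 S T (sto : lact gT S) (tto : lact gT T) u :
  prod_act sto tto 1%g u = u.
Proof. by case: u => x y; rewrite /prod_act !lact1. Qed.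

Lemma prod_actM S T (sto : lact gT S) (tto : lact gT T) a b u :
  prod_act sto tto (a * b)%g u = prod_act sto tto a (prod_act sto tto b u).
Proof. by case: u => x y; rewrite /prod_act !lactM. Qed.

Definition prod_lact S T (sto : lact gT S) (tto : lact gT T) :
  lact gT (S * T)%type := Lact (prod_act1 sto tto) (prod_actM sto tto).

End LeftActions.

Section InvariantFunctions.
Variables (A : comNzRingType) (gT : finGroupType).

Section Def.
Variables (S : finType) (to : lact gT S).

Definition inv_pred : {pred {ffun S -> A^o}} :=
  fun h => [forall a, forall x, h (to a x) == h x].

Lemma inv_predP (h : {ffun S -> A^o}) :
  reflect (forall a x, h (to a x) = h x) (h \in inv_pred).
Proof.
apply: (iffP forallP) => [inv_h a x | inv_h a].
  by have /forallP/(_ x)/eqP := inv_h a.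
by apply/forallP => x; apply/eqP.
Qed.

Lemma inv_submod_closed : submod_closed inv_pred.
Proof.
split; first by apply/inv_predP => a x; rewrite !ffunE.
move=> c g h /inv_predP inv_g /inv_predP inv_h; apply/inv_predP => a x.
by rewrite !ffunE inv_g inv_h.
Qed.

HB.instance Definition _ :=
  GRing.isSubmodClosed.Build A _ inv_pred inv_submod_closed.

Record inv_fun := InvFun {
  inv_val :> {ffun S -> A^o};
  inv_valP : inv_val \in inv_pred }.

HB.instance Definition _ := [isSub for inv_val].
HB.instance Definition _ := [Choice of inv_fun by <:].
HB.instance Definition _ := [SubChoice_isSubZmodule of inv_fun by <:].
HB.instance Definition _ := [SubZmodule_isSubLmodule of inv_fun by <:].

Lemma inv_funE (h : inv_fun) a x : h (to a x) = h x.
Proof. by move/inv_predP: (inv_valP h) => ->. Qed.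

Lemma inv_funP (g h : inv_fun) : (forall x, g x = h x) -> g = h.
Proof. by move=> eq_gh; apply/val_inj/ffunP. Qed.

End Def.

(* The library's lalgType and algType require 1 != 0, which fails here when   *)
(* S is empty; conv_alg and vconv_alg are therefore equipped with structures  *)
(* of ring and of A-module, whose compatibility is [v]conv_scalerAl and       *)
(* [v]conv_scalerAr.                                                          *)
Section Convolution.
Variables (S : finType) (to : lact gT S).

Definition conv_alg := inv_fun (prod_lact to to).
HB.instance Definition _ := GRing.Lmodule.on conv_alg.

Implicit Types g h : conv_alg.

Definition conv_val g h : {ffun S * S -> A^o} :=
  [ffun t => \sum_(z : S) (g (t.1, z) : A) * h (z, t.2)].

Fact conv_inv g h : conv_val g h \in inv_pred (prod_lact to to).
Proof.
apply/inv_predP => a [x y]; rewrite !ffunE /=.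
rewrite (reindex (to a)) /=; last exact/onW_bij/lact_bij.
by apply: eq_bigr => z _; rewrite (inv_funE g a (x, z)) (inv_funE h a (z, y)).
Qed.

Definition conv g h : conv_alg := InvFun (conv_inv g h).

Definition conv1_val : {ffun S * S -> A^o} := [ffun t => (t.1 == t.2)%:R].

Fact conv1_inv : conv1_val \in inv_pred (prod_lact to to).
Proof.
apply/inv_predP => a [x y]; rewrite !ffunE /=.
by rewrite (inj_eq (bij_inj (lact_bij to a))).
Qed.

Definition conv1 : conv_alg := InvFun conv1_inv.

Fact convA : associative conv.
Proof.
move=> g h k; apply: inv_funP => -[x y]; rewrite !ffunE /=.
under eq_bigr do rewrite ffunE mulr_sumr.
under [RHS]eq_bigr do rewrite ffunE mulr_suml.
rewrite exchange_big; apply: eq_bigr => z _; apply: eq_bigr => w _ /=.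
by rewrite mulrA.
Qed.

Fact conv1g : left_id conv1 conv.
Proof.
move=> h; apply: inv_funP => -[x y]; rewrite !ffunE /= (bigD1 x) //=.
rewrite !ffunE /= eqxx mul1r big1 ?addr0 // => z /negPf.
by rewrite ffunE /= eq_sym => ->; rewrite mul0r.
Qed.

Fact convg1 : right_id conv1 conv.
Proof.
move=> h; apply: inv_funP => -[x y]; rewrite !ffunE /= (bigD1 y) //=.
rewrite !ffunE /= eqxx mulr1 big1 ?addr0 // => z /negPf.
by rewrite ffunE /= => ->; rewrite mulr0.
Qed.

Fact convDl : left_distributive conv +%R.
Proof.
move=> g h k; apply: inv_funP => -[x y]; rewrite !ffunE /= -big_split.
by apply: eq_bigr => z _; rewrite /= !ffunE mulrDl.
Qed.

Fact convDr : right_distributive conv +%R.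
Proof.
move=> g h k; apply: inv_funP => -[x y]; rewrite !ffunE /= -big_split.
by apply: eq_bigr => z _; rewrite /= !ffunE mulrDr.
Qed.

HB.instance Definition _ := GRing.Zmodule_isPzRing.Build conv_alg
  convA conv1g convg1 convDl convDr.

Lemma conv_scalerAl (c : A) g h : c *: (g * h) = (c *: g) * h.
Proof.
apply: inv_funP => -[x y]; rewrite !ffunE /= /GRing.scale /= mulr_sumr.
by apply: eq_bigr => z _; rewrite !ffunE mulrA.
Qed.

Lemma conv_scalerAr (c : A) g h : c *: (g * h) = g * (c *: h).
Proof.
apply: inv_funP => -[x y]; rewrite !ffunE /= /GRing.scale /= mulr_sumr.
by apply: eq_bigr => z _; rewrite !ffunE mulrCA.
Qed.

End Convolution.

Section VConvolution.
Variables (V : finZmodType) (vto : alact gT V) (S : finType) (to : lact gT S).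

Definition vconv_alg := inv_fun (prod_lact (prod_lact to to) vto).
HB.instance Definition _ := GRing.Lmodule.on vconv_alg.

Implicit Types g h : vconv_alg.

Definition vconv_val g h : {ffun S * S * V -> A^o} :=
  [ffun t => \sum_(z : S) \sum_(mu : V)
     (g (t.1.1, z, mu) : A) * h (z, t.1.2, t.2 - mu)].

Fact vconv_inv g h :
  vconv_val g h \in inv_pred (prod_lact (prod_lact to to) vto).
Proof.
apply/inv_predP => a [[x y] w]; rewrite !ffunE /=.
rewrite (reindex (to a)) /=; last exact/onW_bij/lact_bij.
apply: eq_bigr => z _.
rewrite (reindex (vto a)) /=; last exact/onW_bij/lact_bij.
apply: eq_bigr => mu _; rewrite -alactB.
by rewrite (inv_funE g a (x, z, mu)) (inv_funE h a (z, y, w - mu)).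
Qed.

Definition vconv g h : vconv_alg := InvFun (vconv_inv g h).

Definition vconv1_val : {ffun S * S * V -> A^o} :=
  [ffun t => ((t.1.1 == t.1.2) && (t.2 == 0))%:R].

Fact vconv1_inv : vconv1_val \in inv_pred (prod_lact (prod_lact to to) vto).
Proof.
have vto0 a : vto a 0 = 0 by rewrite -[X in vto a X](subrr 0) alactB subrr.
apply/inv_predP => a [[x y] w]; rewrite !ffunE /=.
rewrite (inj_eq (bij_inj (lact_bij to a))) -{1}(vto0 a).
by rewrite (inj_eq (bij_inj (lact_bij vto a))).
Qed.

Definition vconv1 : vconv_alg := InvFun vconv1_inv.

Fact vconvA : associative vconv.
Proof.
move=> g h k; apply: inv_funP => -[[x y] w]; rewrite !ffunE /=.
transitivity (\sum_z \sum_mu \sum_z' \sum_nu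
    (g (x, z, mu) : A) * h (z, z', nu) * k (z', y, w - mu - nu)).
  apply: eq_bigr => z _; apply: eq_bigr => mu _; rewrite ffunE mulr_sumr.
  apply: eq_bigr => z' _; rewrite mulr_sumr; apply: eq_bigr => nu _.
  by rewrite mulrA.
symmetry.
transitivity (\sum_z' \sum_nu \sum_z \sum_mu
    (g (x, z, mu) : A) * h (z, z', nu - mu) * k (z', y, w - nu)).
  apply: eq_bigr => z' _; apply: eq_bigr => nu _; rewrite ffunE mulr_suml.
  by apply: eq_bigr => z _; rewrite mulr_suml.
under eq_bigr do rewrite exchange_big.
rewrite exchange_big; apply: eq_bigr => z _ /=.
under eq_bigr do rewrite exchange_big.
rewrite exchange_big; apply: eq_bigr => mu _; apply: eq_bigr => z' _ /=.
rewrite (reindex (fun nu => nu + mu)) /=; last first.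
  by exists (fun nu => nu - mu) => nu _; rewrite ?addrK ?subrK.
by apply: eq_bigr => nu _; rewrite addrK opprD addrA addrAC.
Qed.

Fact vconv1g : left_id vconv1 vconv.
Proof.
move=> h; apply: inv_funP => -[[x y] w]; rewrite !ffunE /= (bigD1 x) //=.
rewrite (bigD1 0) //= !ffunE /= !eqxx mul1r subr0 !big1 ?addr0 //.
  move=> z /negPf zx; apply: big1 => mu _.
  by rewrite ffunE /= eq_sym zx mul0r.
by move=> mu /negPf mu0; rewrite ffunE /= mu0 andbF mul0r.
Qed.

Fact vconvg1 : right_id vconv1 vconv.
Proof.
move=> h; apply: inv_funP => -[[x y] w]; rewrite !ffunE /= (bigD1 y) //=.
rewrite (bigD1 w) //= !ffunE /= subrr !eqxx mulr1 !big1 ?addr0 //.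
  move=> z /negPf zy; apply: big1 => mu _.
  by rewrite ffunE /= zy mulr0.
move=> mu /negPf mu0; rewrite ffunE /= subr_eq0 eq_sym mu0 andbF.
by rewrite mulr0.
Qed.

Fact vconvDl : left_distributive vconv +%R.
Proof.
move=> g h k; apply: inv_funP => -[[x y] w]; rewrite !ffunE /= -big_split.
apply: eq_bigr => z _; rewrite -big_split; apply: eq_bigr => mu _.
by rewrite /= !ffunE mulrDl.
Qed.

Fact vconvDr : right_distributive vconv +%R.
Proof.
move=> g h k; apply: inv_funP => -[[x y] w]; rewrite !ffunE /= -big_split.
apply: eq_bigr => z _; rewrite -big_split; apply: eq_bigr => mu _.
by rewrite /= !ffunE mulrDr.
Qed.

HB.instance Definition _ := GRing.Zmodule_isPzRing.Build vconv_alg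
  vconvA vconv1g vconvg1 vconvDl vconvDr.

Lemma vconv_scalerAl (c : A) g h : c *: (g * h) = (c *: g) * h.
Proof.
apply: inv_funP => -[[x y] w]; rewrite !ffunE /= /GRing.scale /= mulr_sumr.
apply: eq_bigr => z _; rewrite mulr_sumr; apply: eq_bigr => mu _.
by rewrite !ffunE mulrA.
Qed.

Lemma vconv_scalerAr (c : A) g h : c *: (g * h) = g * (c *: h).
Proof.
apply: inv_funP => -[[x y] w]; rewrite !ffunE /= /GRing.scale /= mulr_sumr.
apply: eq_bigr => z _; rewrite mulr_sumr; apply: eq_bigr => mu _.
by rewrite !ffunE mulrCA.
Qed.

End VConvolution.
End InvariantFunctions.

Section FiniteVspace.
Import VectorInternalTheory.
Variables (F : finFieldType) (vT : vectType F).
HB.instance Definition _ := [Countable of {vspace vT} by <:].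
HB.instance Definition _ := [Finite of {vspace vT} by <:].
End FiniteVspace.

Section Geometry.
Variable F : finFieldType.

(* As in the library's {'GL_d[F]}, d is written d.-1.+1, which is d if d > 0. *)
Definition V (d : nat) := 'cV[F]_d.-1.+1.
HB.instance Definition _ d := Vector.on (V d).
HB.instance Definition _ d := FinRing.Zmodule.on (V d).

Definition V_act d (g : {'GL_d[F]}) (w : V d) : V d := GLval g *m w.

Fact V_act1 d w : V_act (1%g : {'GL_d[F]}) w = w.
Proof. exact: mul1mx. Qed.

Fact V_actM d (g h : {'GL_d[F]}) w : V_act (g * h)%g w = V_act g (V_act h w).
Proof. by rewrite /V_act GL_MxE mulmxA. Qed.

Fact V_actB d (g : {'GL_d[F]}) u w : V_act g (u - w) = V_act g u - V_act g w.
Proof. exact: mulmxBr. Qed.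

Definition V_lact d : alact {'GL_d[F]} (V d) :=
  @ALact _ _ (Lact (@V_act1 d) (@V_actM d)) (@V_actB d).

Fact V_act_linear d (g : {'GL_d[F]}) : linear (V_act g).
Proof. by move=> a u w; rewrite /V_act mulmxDr -scalemxAr. Qed.

HB.instance Definition _ d g :=
  GRing.isLinear.Build F (V d) (V d) _ (V_act g) (@V_act_linear d g).

Section Flags.
Variables n d : nat.

Definition flag_pred : {pred {ffun 'I_n.+1 -> {vspace V d}}} :=
  fun f => [&& f ord0 == 0%VS, f ord_max == fullv
    & [forall i : 'I_n.+1, forall j : 'I_n.+1, (i <= j)%N ==> (f i <= f j)%VS]].

Record flag := Flag {
  flag_val :> {ffun 'I_n.+1 -> {vspace V d}};
  flag_valP : flag_val \in flag_pred }.

HB.instance Definition _ := [isSub for flag_val].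
HB.instance Definition _ := [Finite of flag by <:].

Definition vspace_act (g : {'GL_d[F]}) (U : {vspace V d}) : {vspace V d} :=
  (linfun (V_act g) @: U)%VS.

Fact vspace_act1 U : vspace_act 1%g U = U.
Proof.
rewrite /vspace_act; have -> : linfun (V_act (1%g : {'GL_d[F]})) = \1%VF.
  by apply/lfunP => w; rewrite lfunE id_lfunE /= V_act1.
exact: lim1g.
Qed.

Fact vspace_actM g h U : vspace_act (g * h)%g U = vspace_act g (vspace_act h U).
Proof.
rewrite /vspace_act -limg_comp; congr (_ @: _)%VS.
by apply/lfunP => w; rewrite comp_lfunE !lfunE /= V_actM.
Qed.

Fact dim_vspace_act g U : \dim (vspace_act g U) = \dim U.
Proof.
apply: limg_dim_eq; suff -> : lker (linfun (V_act g)) = 0%VS by rewrite capv0.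
apply/eqP/lker0P => u w; rewrite !lfunE /=.
exact: (bij_inj (lact_bij (V_lact d) g)).
Qed.

Fact flag_act_subproof (g : {'GL_d[F]}) (f : flag) :
  [ffun i => vspace_act g (f i)] \in flag_pred.
Proof.
have /and3P[/eqP f0 /eqP fn fS] := flag_valP f.
apply/and3P; rewrite !ffunE; split.
- by rewrite f0 /vspace_act limg0.
- by rewrite eqEdim subvf fn dim_vspace_act /=.
- apply/forallP => i; apply/forallP => j; apply/implyP => le_ij.
  rewrite !ffunE limgS //.
  by have /forallP/(_ i)/forallP/(_ j)/implyP/(_ le_ij) := fS.
Qed.

Definition flag_act g f : flag := Flag (flag_act_subproof g f).

Fact flag_act1 f : flag_act 1%g f = f.
Proof. by apply/val_inj/ffunP => i; rewrite ffunE vspace_act1. Qed.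

Fact flag_actM g h f : flag_act (g * h)%g f = flag_act g (flag_act h f).
Proof. by apply/val_inj/ffunP => i; rewrite !ffunE vspace_actM. Qed.

Definition flag_lact : lact {'GL_d[F]} flag := Lact flag_act1 flag_actM.

End Flags.

Section CompleteFlags.
Variable d : nat.

Definition cflag_pred : {pred flag d d} :=
  fun f => [forall i : 'I_d.+1, \dim (f i) == i].

Record cflag := CFlag {
  cflag_val :> flag d d;
  cflag_valP : cflag_val \in cflag_pred }.

HB.instance Definition _ := [isSub for cflag_val].
HB.instance Definition _ := [Finite of cflag by <:].

Fact cflag_act_subproof (g : {'GL_d[F]}) (f : cflag) :
  flag_lact d d g f \in cflag_pred.
Proof.
have /forallP dim_f := cflag_valP f.
by apply/forallP => i; rewrite ffunE dim_vspace_act.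
Qed.

Definition cflag_act g f : cflag := CFlag (cflag_act_subproof g f).

Fact cflag_act1 f : cflag_act 1%g f = f.
Proof. exact/val_inj/lact1. Qed.

Fact cflag_actM g h f : cflag_act (g * h)%g f = cflag_act g (cflag_act h f).
Proof. exact/val_inj/lactM. Qed.

Definition cflag_lact : lact {'GL_d[F]} cflag := Lact cflag_act1 cflag_actM.

End CompleteFlags.

(* The semidirect product of V by GL(V).                                      *)
Section Affine.
Variable d : nat.

Definition affine := (V d * {'GL_d[F]})%type.
HB.instance Definition _ := Finite.on affine.

Implicit Types a b c : affine.

Definition affine_mul a b : affine := (a.1 + V_act a.2 b.1, (a.2 * b.2)%g).
Definition affine_one : affine := (0, 1%g).
Definition affine_inv a : affine := (- V_act a.2^-1%g a.1, a.2^-1%g).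

Fact affine_mulA : associative affine_mul.
Proof.
move=> a b c; rewrite /affine_mul /= V_actM linearD addrA.
by rewrite mulgA.
Qed.

Fact affine_mul1g : left_id affine_one affine_mul.
Proof. by case=> u g; rewrite /affine_mul /= V_act1 add0r mul1g. Qed.

Fact affine_mulVg : left_inverse affine_one affine_inv affine_mul.
Proof. by case=> u g; rewrite /affine_mul /= addNr mulVg. Qed.

HB.instance Definition _ :=
  Finite_isGroup.Build affine affine_mulA affine_mul1g affine_mulVg.

Variables (S : Type) (to : lact {'GL_d[F]} S).

Definition affine_act a (x : S * V d) : S * V d :=
  (to a.2 x.1, V_act a.2 x.2 + a.1).

Fact affine_act1 x : affine_act 1%g x = x.
Proof. by case: x => s u; rewrite /affine_act /= lact1 V_act1 addr0. Qed.

Fact affine_actM a b x :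
  affine_act (a * b)%g x = affine_act a (affine_act b x).
Proof.
rewrite /affine_act /= lactM V_actM linearD -addrA.
by rewrite [a.1 + _]addrC.
Qed.

Definition affine_lact : lact affine (S * V d)%type :=
  Lact affine_act1 affine_actM.

End Affine.

(* The prefix cal marks the script-letter variants, on which GL_d(F) acts.      *)
Definition calMS (n d : nat) :=
  vconv_alg laurent (V_lact d) (flag_lact n d).
Definition calMH (d : nat) := vconv_alg laurent (V_lact d) (cflag_lact d).
Definition calMV (n d : nat) :=
  inv_fun laurent
    (prod_lact (prod_lact (flag_lact n d) (cflag_lact d)) (V_lact d)).

Definition MS (n d : nat) := conv_alg laurent (affine_lact (flag_lact n d)).
Definition MH (d : nat) := conv_alg laurent (affine_lact (cflag_lact d)).
Definition MV (n d : nat) :=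
  inv_fun laurent
    (prod_lact (affine_lact (flag_lact n d)) (affine_lact (cflag_lact d))).

End Geometry.

(* Main.v *)
Require Import Defs.
From HB Require Import structures.
From mathcomp Require Import all_boot all_order all_fingroup all_algebra.
Import GRing.Theory.
Local Open Scope ring_scope.

(** Every orbit of the translation subgroup of V x| G on (S x V) x (T x V)
    meets the slice of points ((x, 0), (y, w)) exactly once, since
    ((x, u), (y, w)) is the translate by u of ((x, 0), (y, w - u)); and G, which
    fixes 0, is the stabilizer of the slice.  Restricting to the slice is
    therefore a linear bijection [slice] from the (V x| G)-invariant functions
    on (S x V) x (T x V) to the G-invariant functions on S x T x V, with inverse
    h |-> (((x, u), (y, w)) |-> h (x, y, w - u)) ([unslice]).  Here
    S and T are arbitrary finite G-sets, so that all three cases are covered.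

    When S = T, [slice] turns one convolution into the other: in the sum of
    g ((x, 0), (z, mu)) * h ((z, mu), (y, w)), the second factor is
    slice h (z, y, w - mu), again by translation ([sliceM]). *)

Section Slice.
Set Implicit Arguments.
Unset Strict Implicit.
Unset Printing Implicit Defensive.

Variables (F : finFieldType) (d : nat) (A : comNzRingType).

Section TwoSets.
Variables (S T : finType) (sto : lact {'GL_d[F]} S) (tto : lact {'GL_d[F]} T).

Local Notation affine_inv_fun :=
  (inv_fun A (prod_lact (affine_lact sto) (affine_lact tto))).
Local Notation linear_inv_fun :=
  (inv_fun A (prod_lact (prod_lact sto tto) (V_lact F d))).

Lemma affine_inv_funE (h : affine_inv_fun) v (a : {'GL_d[F]}) x u y w :
  h ((sto a x, V_act a u + v), (tto a y, V_act a w + v)) = h ((x, u), (y, w)).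
Proof. exact: (inv_funE h (v, a) ((x, u), (y, w))). Qed.

Lemma affine_inv_fun_translate (h : affine_inv_fun) x y u w :
  h ((x, u), (y, w)) = h ((x, 0), (y, w - u)).
Proof.
by have := affine_inv_funE h (- u) 1%g x u y w; rewrite !lact1 !V_act1 subrr.
Qed.

Lemma affine_inv_fun_linear (h : affine_inv_fun) (a : {'GL_d[F]}) x y w :
  h ((sto a x, 0), (tto a y, V_act a w)) = h ((x, 0), (y, w)).
Proof.
by have := affine_inv_funE h 0 a x 0 y w; rewrite [V_act a 0]mulmx0 !addr0.
Qed.

Definition slice_val (h : affine_inv_fun) : {ffun S * T * V F d -> A^o} :=
  [ffun t => h ((t.1.1, 0), (t.1.2, t.2))].

Fact slice_inv h :
  slice_val h \in inv_pred (prod_lact (prod_lact sto tto) (V_lact F d)).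
Proof.
apply/inv_predP => a [[x y] w]; rewrite !ffunE /=.
exact: affine_inv_fun_linear.
Qed.

Definition slice h : linear_inv_fun := InvFun (slice_inv h).

Definition unslice_val (h : linear_inv_fun) :
    {ffun (S * V F d) * (T * V F d) -> A^o} :=
  [ffun t => h ((t.1.1, t.2.1), t.2.2 - t.1.2)].

(** The translation part of the acting element cancels in the difference of the
    two vectors, and its linear part commutes with taking that difference. *)
Fact unslice_inv h :
  unslice_val h \in inv_pred (prod_lact (affine_lact sto) (affine_lact tto)).
Proof.
apply/inv_predP => a [[x u] [y w]]; rewrite !ffunE /=.
by rewrite opprD addrACA subrr addr0 -V_actB (inv_funE h a.2 ((x, y), w - u)).
Qed.

Definition unslice h : affine_inv_fun := InvFun (unslice_inv h).

Lemma sliceK : cancel slice unslice.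
Proof.
move=> h; apply: inv_funP => -[[x u] [y w]]; rewrite !ffunE /=.
by rewrite -affine_inv_fun_translate.
Qed.

Lemma unsliceK : cancel unslice slice.
Proof.
by move=> h; apply: inv_funP => -[[x y] w]; rewrite !ffunE /= subr0.
Qed.

Lemma slice_bij : bijective slice.
Proof. exact: Bijective sliceK unsliceK. Qed.

Lemma slice_linear : linear slice.
Proof. by move=> c g h; apply: inv_funP => t; rewrite !ffunE. Qed.

HB.instance Definition _ :=
  GRing.isLinear.Build A affine_inv_fun linear_inv_fun _ slice slice_linear.

Lemma slice_linear_iso :
  exists phi : {linear affine_inv_fun -> linear_inv_fun}, bijective phi.
Proof. by exists slice; apply: slice_bij. Qed.

End TwoSets.

Section Algebra.
Variables (S : finType) (sto : lact {'GL_d[F]} S).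

Local Notation affine_alg := (conv_alg A (affine_lact sto)).
Local Notation linear_alg := (vconv_alg A (V_lact F d) sto).

Definition slice_alg : affine_alg -> linear_alg := @slice S S sto sto.

Lemma slice1 : slice_alg 1 = 1.
Proof.
apply: inv_funP => -[[x y] w]; rewrite !ffunE /=.
by rewrite xpair_eqE [0 == w]eq_sym.
Qed.

(** The intermediate point (z, mu) of the affine convolution supplies both
    summation indices of the other one; translating it to (z, 0) in the second
    factor produces the shift w - mu. *)
Lemma sliceM : {morph slice_alg : g h / g * h}.
Proof.
move=> g h; apply: inv_funP => -[[x y] w]; rewrite !ffunE /=.
rewrite pair_bigA; apply: eq_bigr => -[z mu] _ /=.
by rewrite !ffunE (affine_inv_fun_translate h z y mu w).
Qed.

HB.instance Definition _ :=
  GRing.isZmodMorphism.Build affine_alg linear_alg slice_alg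
    (raddfB (@slice S S sto sto)).
HB.instance Definition _ :=
  GRing.isMonoidMorphism.Build affine_alg linear_alg slice_alg
    (slice1, sliceM).

Lemma slice_alg_iso :
  exists phi : {rmorphism affine_alg -> linear_alg},
    scalable phi /\ bijective phi.
Proof.
exists slice_alg; split; last exact: slice_bij.
by move=> c h; apply: (linearZZ (@slice S S sto sto)).
Qed.

End Algebra.
End Slice.

Theorem proposition6p1p4 (F : finFieldType) (n d : nat)
    (n_gt0 : (0 < n)%N) (d_gt0 : (0 < d)%N) :
  [/\ exists phi : {rmorphism MS F n d -> calMS F n d},
        scalable phi /\ bijective phi,
      exists phi : {rmorphism MH F d -> calMH F d},
        scalable phi /\ bijective phi
    & exists phi : {linear MV F n d -> calMV F n d}, bijective phi].
Proof.
by split; [exact: slice_alg_iso | exact: slice_alg_iso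
          | exact: slice_linear_iso].
Qed.
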